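(* Fix an integer $m\ge2$ and let $t$ be a positive integer. Then $L_{2t,m}$ is in bijection with the set of $m$-Lyndon binary words of length $t$.
   Context: $G=\mathbb{Z}_2*\mathbb{Z}_3$, where $a$ generates $\mathbb{Z}_2$ and $b$ generates $\mathbb{Z}_3$. The word length of an element of $G$ is the minimum length of a word in $\{a,b,b^{-1}\}$ representing it; the length of a conjugacy class is the minimum word length of its elements. Every infinite order element is conjugate to an (ab)-word $ab^{\epsilon_1}ab^{\epsilon_2}\cdots ab^{\epsilon_t}$, $\epsilon_i=\pm1$. It is $m$-low lying if no $m+1$ consecutive $\epsilon_i$, considered cyclically, have the same sign (equivalently, the cyclic tuple $(\epsilon_1,\dots,\epsilon_t)$ has this property, which is then called $m$-low lying for the tuple). $L_{2t,m}$ is the set of conjugacy classes of $m$-low lying words of length $2t$. An $m$-Lyndon binary word of length $t$ is an $m$-low lying tuple in $\{\pm1\}^t$ that is the lexicographically smallest (with $-1$ preceding $1$) among all its cyclic permutations; it need not be primitive. *)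

(* Defs.v *)
From HB Require Import structures.
From mathcomp Require Import all_boot all_order.
From mathcomp Require Import boolp classical_sets functions.

Set Implicit Arguments.
Unset Strict Implicit.
Unset Printing Implicit Defensive.

Local Open Scope classical_set_scope.
Local Open Scope group_scope.

(** A sign is a boolean, [false] standing for -1 and [true] for +1, so that the
    usual order [false < true] on [bool] puts -1 before +1. *)

(** The letters [None], [Some true], [Some false] are a, b, b^-1, that is, the
    nontrivial elements of the two factors Z_2 = <a> and Z_3 = <b>. *)
Definition letter := option bool.

Definition is_a (x : letter) : bool := x == None.

Definition linv (x : letter) : letter := omap negb x.

(** Elements of the free product Z_2 * Z_3 are represented by their normal
    forms: the words whose letters lie alternately in the two factors. *)
Definition reduced (w : seq letter) : bool :=
  sorted (fun x y => is_a x != is_a y) w.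

(** Left multiplication of a normal form by a letter; the middle case is
    b * b = b^-1 and b^-1 * b^-1 = b. *)
Definition lmul (x : letter) (w : seq letter) : seq letter :=
  match x, w with
  | None, None :: w' => w'
  | Some e, Some e' :: w' => if e == e' then Some (~~ e) :: w' else w'
  | _, _ => x :: w
  end.

Lemma lmul_reduced x w : reduced w -> reduced (lmul x w).
Proof.
case: w => [|y w]; first by case: x.
case: x y => [e|] [e'|] //=; rewrite /reduced /=; try exact: path_sorted.
by case: eqP => // _; [case: w | exact: path_sorted].
Qed.

Definition wmul (u v : seq letter) : seq letter := foldr lmul v u.

Definition winv (w : seq letter) : seq letter := rev (map linv w).

Lemma wmul_reduced u v : reduced v -> reduced (wmul u v).
Proof. by move=> rv; elim: u => //= x u IHu; apply: lmul_reduced. Qed.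

Lemma lmul_cons x w : reduced (x :: w) -> lmul x w = x :: w.
Proof. by case: x w => [e|] [|[e'|] w]. Qed.

Lemma wmul_nil w : reduced w -> wmul w [::] = w.
Proof.
elim: w => //= x w IHw rxw; rewrite IHw ?lmul_cons //.
exact: path_sorted rxw.
Qed.

Lemma lmulK x w : reduced w -> lmul (linv x) (lmul x w) = w.
Proof.
case: x w => [[]|] [|[[]|] [|[[]|] w]] //=.
Qed.

Lemma linvK : involutive linv.
Proof. by case=> [[]|]. Qed.

Lemma lmul_b e w : reduced w -> lmul (Some e) (lmul (Some e) w) =
  lmul (Some (~~ e)) w.
Proof. by case: e w => [] [|[[]|] [|[[]|] w]]. Qed.

Lemma wmul_lmul x u v : reduced v -> wmul (lmul x u) v = lmul x (wmul u v).
Proof.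
case: u => [|y u] rv; first by case: x.
have ru := wmul_reduced u rv; rewrite -[wmul (y :: u) v]/(lmul y (wmul u v)).
case: x y => [e|] [e'|] //; last by rewrite (@lmulK None).
rewrite [lmul _ (_ :: _)]/=; case: eqVneq => [->|ne]; first by rewrite lmul_b.
by rewrite -(_ : linv (Some e') = Some e) ?lmulK //; case: e e' ne => [] [].
Qed.

Lemma wmulA u v w : reduced w -> wmul u (wmul v w) = wmul (wmul u v) w.
Proof.
by move=> rw; elim: u => //= x u ->; rewrite wmul_lmul.
Qed.

Lemma winv_reduced w : reduced w -> reduced (winv w).
Proof.
rewrite /reduced /winv rev_sorted sorted_map.
by apply: sub_sorted => x y; case: x y => [x|] [y|].
Qed.

Lemma wmul_cat u v w : wmul (u ++ v) w = wmul u (wmul v w).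
Proof. exact: foldr_cat. Qed.

Lemma wmulV u : reduced u -> wmul (winv u) u = [::].
Proof.
move=> ru; rewrite -{2}(wmul_nil ru).
have: reduced [::] by []; move: [::] => v.
move=> rv; elim: u {ru} => //= x u IHu.
rewrite /winv /= rev_cons -cats1 wmul_cat /= lmulK ?IHu //.
exact: wmul_reduced.
Qed.

Lemma winvK : involutive winv.
Proof. by move=> w; rewrite /winv map_rev revK (mapK linvK). Qed.

(** The group G = Z_2 * Z_3. *)
Definition G := {w : seq letter | reduced w}.

HB.instance Definition _ := SubChoice.on G.

Definition G1 : G := @exist _ reduced [::] isT.
Definition Gmul (u v : G) : G :=
  @exist _ reduced (wmul (val u) (val v)) (wmul_reduced (val u) (valP v)).
Definition Ginv (u : G) : G :=
  @exist _ reduced (winv (val u)) (winv_reduced (valP u)).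

Lemma GmulA : associative Gmul.
Proof. by move=> u v w; apply: val_inj; rewrite /= wmulA // (valP w). Qed.

Lemma Gmul1 : left_id G1 Gmul.
Proof. by move=> u; apply: val_inj. Qed.

Lemma Gmulr1 : right_id G1 Gmul.
Proof. by move=> u; apply: val_inj; rewrite /= wmul_nil // (valP u). Qed.

Lemma GmulV : left_inverse G1 Ginv Gmul.
Proof. by move=> u; apply: val_inj; rewrite /= wmulV // (valP u). Qed.

Lemma GmulrV : right_inverse G1 Ginv Gmul.
Proof.
move=> u; apply: val_inj => /=; rewrite -{1}[val u]winvK wmulV //.
exact: winv_reduced (valP u).
Qed.

HB.instance Definition _ := isGroup.Build G GmulA Gmul1 Gmulr1 GmulV GmulrV.

Definition ga : G := @exist _ reduced [:: None] isT.
Definition gb : G := @exist _ reduced [:: Some true] isT.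

Definition gletter (x : letter) : G :=
  match x with None => ga | Some e => if e then gb else gb^-1 end.

Definition spell (w : seq letter) : G := \prod_(x <- w) gletter x.

Lemma val_spell w : val (spell w) = wmul w [::].
Proof.
rewrite /spell; elim: w => [|x w IHw]; first by rewrite big_nil.
by rewrite big_cons /= IHw; case: x => [[]|].
Qed.

Lemma spell_val (g : G) : spell (val g) = g.
Proof. by apply: val_inj; rewrite val_spell wmul_nil // (valP g). Qed.

(** G is indeed the free product: it has the universal property of
    <a | a^2> * <b | b^3>. *)
Lemma G_free_product :
  [/\ ga ^+ 2 = 1, gb ^+ 3 = 1 &
  forall (H : groupType) (x y : H), x ^+ 2 = 1 -> y ^+ 3 = 1 ->
    exists f : G -> H,
      [/\ {morph f : u v / u * v}, f ga = x, f gb = y &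
      forall f' : G -> H, {morph f' : u v / u * v} ->
        f' ga = x -> f' gb = y -> f' =1 f]].
Proof.
split; [exact: val_inj | exact: val_inj |] => H x y x2 y3.
pose h (l : letter) : H :=
  match l with None => x | Some e => if e then y else y^-1 end.
pose F (w : seq letter) : H := \prod_(l <- w) h l.
have xx : x * x = 1 by [].
have yy : y * y = y^-1.
  by apply: (mulgI y); rewrite mulgV -y3.
have vv : y^-1 * y^-1 = y by rewrite -invgM yy invgK.
have Fl l w : F (lmul l w) = h l * F w.
  rewrite /F; case: w => [|l' w]; first by case: l => [e|]; rewrite !(big_cons, big_nil).
  case: l l' => [[]|] [[]|] //=;
    by rewrite !big_cons // mulgA ?xx ?yy ?vv ?mulgV ?mulVg ?mul1g.
have FM u v : F (wmul u v) = F u * F v.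
  elim: u => [|l u IHu] /=; first by rewrite /F big_nil mul1g.
  by rewrite Fl IHu mulgA /F big_cons.
exists (fun g => F (val g)); split.
- by move=> u v; rewrite -FM.
- by rewrite /F /= big_cons big_nil mulg1.
- by rewrite /F /= big_cons big_nil mulg1.
move=> f' f'M f'a f'b g.
have f'1 : f' 1 = 1 by apply: (mulgI (f' 1)); rewrite -f'M !mulg1.
have f'V u : f' u^-1 = (f' u)^-1.
  by apply: (mulgI (f' u)); rewrite -f'M !mulgV.
rewrite -{1}(spell_val g) /spell /F (big_morph f' f'M f'1).
by apply: eq_bigr => -[[]|] _ //=; rewrite ?f'V ?f'a ?f'b.
Qed.

Lemma exists_word (g : G) :
  exists n, [exists w : n.-tuple letter, spell w == g].
Proof.
exists (size (val g)); apply/existsP; exists (in_tuple (val g)).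
exact/eqP/spell_val.
Qed.

Definition word_length (g : G) : nat := ex_minn (exists_word g).

Definition conj_class (g : G) : set G := [set h : G | exists x : G, h = g ^ x].

(** The (ab)-word a b^{e_1} a b^{e_2} ... a b^{e_t}. *)
Definition ab_word (e : seq bool) : G :=
  \prod_(s <- e) (ga * gletter (Some s)).

(** No [m.+1] cyclically consecutive signs are equal. Indices are taken modulo
    the length of [e], and the window may wrap around [e] more than once: a
    constant nonempty tuple is never m-low lying. *)
Definition low_lying (m : nat) (e : seq bool) : bool :=
  ~~ [exists i : 'I_(size e), exists s : bool,
        forall j : 'I_m.+1, nth s e ((i + j) %% size e) == s].

(** The length of an m-low lying word is its word length as an element of G,
    so the number of its blocks is not prescribed separately. *)
Definition L (n m : nat) : set (set G) :=
  [set C : set G | exists e : seq bool,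
     [/\ low_lying m e, word_length (ab_word e) = n & C = conj_class (ab_word e)]].

Definition m_Lyndon (m t : nat) : set (t.-tuple bool) :=
  [set w : t.-tuple bool | low_lying m w /\
           forall k : nat, ((w : seqlexi bool) <= rot k w)%O].
Arguments m_Lyndon : clear implicits.

(* Main.v *)
Require Import Defs.
From mathcomp Require Import all_boot all_order.
From mathcomp Require Import boolp classical_sets functions.
From mathcomp Require Import zify.

(** Two (ab)-words are conjugate if and only if their sign tuples are cyclic
    permutations of each other; each conjugacy class then corresponds to the
    least rotation of its tuples.  For the "only if" part, let [g x = x h] with
    [g], [h] (ab)-words of the same length.  If [x] starts with a, the product
    [g x] is reduced as written; counting letters, so is [x h], and [g], [h]
    are cyclic permutations of each other as words.  If [x] starts with a
    b-letter, conjugating [g] by its last block a b^e either shortens [x] or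
    makes it start with a. *)

Set Implicit Arguments.
Unset Strict Implicit.
Unset Printing Implicit Defensive.

Lemma size_lmul x w : size (lmul x w) <= (size w).+1.
Proof.
by case: x w => [e|] [|[e'|] w] //=; [case: ifP => _ /=; lia | lia].
Qed.

Lemma size_wmul u v : size (wmul u v) <= size u + size v.
Proof.
elim: u => //= x u IHu; rewrite addSn.
exact: leq_trans (size_lmul _ _) _.
Qed.

(** The normal form itself spells [g], and multiplying out a word letter by letter never produces
    more letters than the word has. *)
Lemma word_lengthE (g : G) : word_length g = size (val g).
Proof.
rewrite /word_length; case: ex_minnP => n /existsP[w /eqP <-] n_min.
apply/eqP; rewrite eqn_leq n_min /=; last first.
  apply/existsP; exists (in_tuple (val (spell w))); apply/eqP.
  exact: spell_val.
by rewrite val_spell (leq_trans (size_wmul _ _)) ?size_tuple ?addn0.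
Qed.

Lemma wmul_reduced_cat u v : reduced (u ++ v) -> wmul u v = u ++ v.
Proof.
elim: u => //= x u IHu rxuv; rewrite IHu ?lmul_cons //.
exact: path_sorted rxuv.
Qed.

Definition ab_letters (e : seq bool) : seq letter :=
  flatten [seq [:: None; Some s] | s <- e].

Lemma size_ab_letters e : size (ab_letters e) = 2 * size e.
Proof. by elim: e => //= s e IHe; rewrite IHe mulnS. Qed.

(** Erasing every a turns equations between letter words into equations between sign words. *)
Lemma pmap_ab_letters e : pmap id (ab_letters e) = e.
Proof. by elim: e => //= s e ->. Qed.

Lemma reduced_ab_cat e x :
  reduced x -> is_a (head None x) -> reduced (ab_letters e ++ x).
Proof.
move=> rx hx; elim: e => //= s [|s' e] /= IHe; last exact: IHe.
by case: x rx hx IHe => [|[b|] x].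
Qed.

Lemma reduced_ab_letters e : reduced (ab_letters e).
Proof. by rewrite -[ab_letters e]cats0; exact: reduced_ab_cat. Qed.

Lemma val_ab_word e : val (ab_word e) = ab_letters e.
Proof.
rewrite /ab_word; elim: e => [|s e IHe]; first by rewrite big_nil.
have ->: (\prod_(t <- s :: e) (ga * gletter (Some t)) =
   ga * gletter (Some s) * \prod_(t <- e) (ga * gletter (Some t)))%g.
  by rewrite big_cons.
have r := reduced_ab_letters (s :: e).
move: IHe; rewrite /= => ->.
rewrite -[RHS](@wmul_reduced_cat [:: None; Some s]) //.
by case: s {r}.
Qed.

(** If [x] is longer than [u], it begins with [u], and stripping this prefix preserves the equation.
    Otherwise [x] is a prefix of [u], and [v] is [u] rotated by [size x]. *)
Lemma cat_conj_rot (T : Type) (u x v : seq T) :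
  u ++ x = x ++ v -> exists k, v = rot k u.
Proof.
move: {2}(size x) (leqnn (size x)) => n.
elim: n x => [|n IHn] x sx E.
  by exists 0; case: x sx E => //= _; rewrite cats0 rot0.
have [/size0nil u0|u0] := posnP (size u).
  have v0 : v = [::].
    apply: size0nil; apply/eqP; rewrite -(eqn_add2l (size x)) -size_cat -E u0.
    by rewrite addn0.
  by exists 0; rewrite v0 u0.
have [le|lt] := leqP (size x) (size u).
  exists (size x); move: (E); rewrite -{1}(cat_take_drop (size x) u) -catA /rot.
  move=> {}E; have := congr1 (take (size x)) E.
  have := congr1 (drop (size x)) E.
  by rewrite !take_size_cat ?drop_size_cat ?size_takel // => <- {2}<-.
have E1 := congr1 (drop (size u)) E.
have E2 := congr1 (take (size u)) E.
rewrite drop_size_cat // drop_cat lt in E1.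
rewrite take_size_cat // take_cat lt in E2.
apply: (IHn (drop (size u) x)).
  by rewrite size_drop /=; lia.
by rewrite {1}E2 cat_take_drop.
Qed.

(* The empty [x] passes the test on the head.  If [x] ended in a, this a would
   cancel the first letter of [ab_letters e'], leaving the right-hand product too
   short. *)
Lemma ab_conj_head_a e e' x : size e = size e' -> 0 < size e ->
  reduced x -> is_a (head None x) ->
  wmul (ab_letters e) x = wmul x (ab_letters e') -> exists k, e' = rot k e.
Proof.
move=> see e0 rx hx; rewrite wmul_reduced_cat; last exact: reduced_ab_cat.
case: e' see => [see|s e' see]; first by rewrite see in e0.
case/lastP: x rx hx => [|x [b|]] rx hx.
- rewrite cats0 /= => /(congr1 (pmap id)) /=.
  by rewrite !pmap_ab_letters => ->; exists 0; rewrite rot0.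
- rewrite wmul_reduced_cat.
    (* Both products are now plain concatenations, so erasing the a's leaves an equation u x = x v
       of sign words. *)
    move=> /(congr1 (pmap id)); rewrite !pmap_cat !pmap_ab_letters.
    exact: cat_conj_rot.
  move: (reduced_ab_letters (s :: e')) rx {hx}.
  rewrite /reduced; case: x => [|y x] //= r.
  by rewrite cat_path last_rcons => ->.
- rewrite -cats1 wmul_cat /= => /(congr1 size) E.
  have := size_wmul x (Some s :: ab_letters e').
  rewrite -E !size_cat /= !size_ab_letters see /=; lia.
Qed.

Lemma ab_conj e e' x : size e = size e' -> 0 < size e -> reduced x ->
  wmul (ab_letters e) x = wmul x (ab_letters e') -> exists k, e' = rot k e.
Proof.
move=> see e0; move: {2}(size x) (leqnn (size x)) => n.
elim: n x e see e0 => [|n IHn] x e see e0 sx rx E.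
  by apply: (ab_conj_head_a see e0 rx) => //; case: x sx {rx E}.
have [hx|hx] := boolP (is_a (head None x)).
  exact: ab_conj_head_a see e0 rx hx E.
case/lastP: e see e0 E => // e s see e0 E.
have re' := reduced_ab_letters e'.
(* Conjugation by the last block moves its sign [s] to the front of the tuple and replaces [x] by
   [y]. *)
pose y := wmul [:: None; Some s] x.
have Ey : wmul (ab_letters (s :: e)) y = wmul y (ab_letters e').
  by rewrite /y -wmulA // -E -!wmul_cat /ab_letters map_rcons flatten_rcons.
have ry : reduced y by exact: wmul_reduced.
suff [k ->] : exists k, e' = rot k (s :: e).
  exists (rot_add (rcons e s) (size e) k).
  by rewrite -rot_rot_add -cats1 rot_size_cat.
have ss : size (s :: e) = size e' by rewrite -see size_rcons.
have [hy|hy] := boolP (is_a (head None y)).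
  exact: ab_conj_head_a ss isT ry hy Ey.
apply: IHn Ey => //.
(* A first letter b^s of [x] would merge into b^-s and leave [y] starting with a. Hence b^s cancels
   it, and the a in front then cancels the next letter of [x]: [y] is two letters shorter. *)
move: hy sx; rewrite /y /=; case: x rx hx {y ry E} => [|[b|] x] //= rx _.
case: eqP => //= _; case: x rx => [|[c|] x] //= _ _; lia.
Qed.

Lemma ab_word_cat u v : ab_word (u ++ v) = (ab_word u * ab_word v)%g.
Proof. exact: big_cat. Qed.

Lemma conj_classJ (g x : G) : conj_class (g ^ x)%g = conj_class g.
Proof.
apply/seteqP; split=> h [y ->]; first by exists (x * y)%g; rewrite conjgM.
by exists (x^-1 * y)%g; rewrite -conjgM mulVKg.
Qed.

(** Conjugating u v by its prefix u gives v u. *)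
Lemma conj_class_ab_rot k e :
  conj_class (ab_word (rot k e)) = conj_class (ab_word e).
Proof.
rewrite -[in RHS](cat_take_drop k e) /rot !ab_word_cat.
by rewrite -[RHS](conj_classJ _ (ab_word (take k e))) conjgE -mulgA mulKg.
Qed.

Lemma conj_class_ab_eq e e' : size e = size e' ->
  conj_class (ab_word e) = conj_class (ab_word e') -> exists k, e' = rot k e.
Proof.
move=> see E; have [e0|e0] := posnP (size e).
  by exists 0; rewrite rot0 (size0nil e0) [e']size0nil // -see.
have [x Ex] : conj_class (ab_word e) (ab_word e').
  by rewrite E; exists 1%g; rewrite conjg1.
apply: (@ab_conj e e' (val x)) => //; first exact: valP.
rewrite -!val_ab_word Ex.
by rewrite -[LHS]/(val (ab_word e * x)%g) -[RHS]/(val (x * _)%g) -conjgC.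
Qed.

Lemma nth_rot_mod (T : Type) (x : T) s k i : k <= size s ->
  nth x (rot k s) (i %% size s) = nth x s ((i + k) %% size s).
Proof.
have [/size0nil -> _|s0 ks] := posnP (size s).
  by rewrite /rot /= !nth_default.
rewrite /rot nth_cat size_drop -[in RHS]modnDml.
have := ltn_pmod i s0; set j := i %% _ => js; case: ltnP => jk.
  by rewrite nth_drop modn_small addnC //; lia.
rewrite nth_take; last by lia.
have -> : j + k = j - (size s - k) + size s by lia.
by rewrite modnDr modn_small //; lia.
Qed.

(** The window at [i] in the rotated tuple is the window at [i + k] in [e]. *)
Lemma low_lying_rot m k e : low_lying m e -> low_lying m (rot k e).
Proof.
have [ke|ke] := leqP k (size e); last by rewrite rot_oversize // ltnW.
apply: contra => /existsP[i /existsP[s /forallP H]].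
have e0 : 0 < size e by rewrite -(size_rot k) (leq_ltn_trans _ (ltn_ord i)).
apply/existsP; exists (Ordinal (ltn_pmod (i + k) e0)).
apply/existsP; exists s; apply/forallP => j /=.
by rewrite modnDml addnAC -nth_rot_mod // -(size_rot k e); exact: H.
Qed.

(** Rotations by [size e] or more are trivial, so a minimum over finitely many suffices. *)
Lemma exists_least_rot (e : seq bool) :
  exists k, forall j, ((rot k e : seqlexi bool) <= rot j e)%O.
Proof.
have [k _ k_min] := @Order.TotalTheory.arg_minP _ (seqlexi bool)
  'I_(size e).+1 ord0 xpredT (fun i => rot i e) isT.
exists k => j; have [je|/ltnW je] := leqP j (size e).
  exact: (k_min (Ordinal (je : j < _.+1))).
by rewrite (rot_oversize je) -[leRHS]rot0; exact: (k_min ord0).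
Qed.

Theorem proposition6p1 (m t : nat) (hm : 2 <= m) (ht : 0 < t) :
  exists f : set G -> t.-tuple bool, set_bij (L (2 * t) m) (m_Lyndon m t) f.
Proof.
pose c (w : t.-tuple bool) := conj_class (ab_word w).
suff c_bij : set_bij (m_Lyndon m t) (L (2 * t) m) c.
  (* The map sought is the inverse of [c]; the constant tuple is an arbitrary value outside
     [L (2 * t) m]. *)
  exact: ex_intro (bijpinv_bij (fun=> nseq_tuple t false) c_bij).
split.
- move=> w [w_low _]; exists w; split=> //.
  by rewrite word_lengthE val_ab_word size_ab_letters size_tuple.
(* Each tuple is a rotation of the other and both are least, so antisymmetry applies. *)
- move=> w w' /set_mem[_ w_min] /set_mem[_ w'_min] E.
  apply/val_inj/(@Order.POrderTheory.le_anti _ (seqlexi bool))/andP; split.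
    by have [|k wk] := conj_class_ab_eq _ E; rewrite ?size_tuple //= wk.
  by have [|k wk] := conj_class_ab_eq _ (esym E);
    rewrite ?size_tuple //= wk.
(* Word length [2 * t] forces [e] to have [t] signs; its least rotation is the preimage. *)
- move=> C [e [e_low]]; rewrite word_lengthE val_ab_word size_ab_letters.
  move=> /eqP; rewrite eqn_pmul2l // => e_t ->.
  have [k k_min] := exists_least_rot e.
  have rt : size (rot k e) == t by rewrite size_rot.
  exists (Tuple rt); last by rewrite /c /= conj_class_ab_rot.
  by split=> [|j] /=; [exact: low_lying_rot | rewrite rot_rot_add].
Qed.
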